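(* Let $\mathbf{Q}$ be a real $m\times n$ matrix with orthonormal rows, $\mathbf{Q}\mathbf{Q}^T=\mathbf{I}_m$, and coherence $\mu$, and let $\mathbf{Q}\mathbf{S}$ be computed by the sampling algorithm (described in the context) with $c$ samples. Given $0<\epsilon<1$ and $0<\delta<1$, we have $\sigma_m(\mathbf{Q}\mathbf{S})\geq\sqrt{1-\epsilon}$ with probability at least $1-\delta$, if the algorithm (i) either samples with ``nearly optimal'' probabilities $p_j^{\beta}$ (independently, with replacement), where $0<\beta\leq 1$, $\sum_{j=1}^n p_j^{\beta}=1$ and $p_j^{\beta}\geq\beta\,\|Q_j\|_2^2/\|\mathbf{Q}\|_F^2$ for $1\leq j\leq n$, and $$c\geq c_1(\epsilon)\,m\,\frac{\ln(m/\delta)}{\beta\,\epsilon^2},$$ (ii) or samples with uniform probabilities $1/n$, with or without replacement, and $$c\geq c_1(\epsilon)\,n\,\mu\,\frac{\ln(m/\delta)}{\epsilon^2}.$$ Here $c_1(\epsilon)\equiv\dfrac{\epsilon^2}{(1-\epsilon)\ln(1-\epsilon)+\epsilon}$, and $1\leq c_1(\epsilon)\leq 2$.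
   Context: $Q_1,\ldots,Q_n$ are the columns of $\mathbf{Q}$; the coherence of $\mathbf{Q}$ is $\mu\equiv\max_{1\leq j\leq n}\|Q_j\|_2^2$. $\sigma_m(\mathbf{Q}\mathbf{S})$ denotes the $m$-th largest singular value of the $m\times c$ matrix $\mathbf{Q}\mathbf{S}$, i.e. the square root of the smallest eigenvalue of $(\mathbf{Q}\mathbf{S})(\mathbf{Q}\mathbf{S})^T$. $\|\cdot\|_2$ is the two-norm and $\|\cdot\|_F$ the Frobenius norm. Sampling algorithm: given $\mathbf{Q}$, a number of samples $1\leq c\leq n$ and probabilities $p_j\geq 0$ with $\sum_{j=1}^n p_j=1$, sample indices $t_1,\ldots,t_c$ from $\{1,\ldots,n\}$ independently and with replacement, with $\mathbb{P}[t_j=i]=p_i$; let $\mathbf{S}$ be the $n\times c$ matrix with columns $e_{t_j}/\sqrt{c\,p_{t_j}}$, where $e_i$ are the columns of $\mathbf{I}_n$. An index $i$ with $p_i=0$ is never selected. Uniform sampling without replacement means that $(t_1,\ldots,t_c)$ is instead a uniformly random sequence of $c$ distinct indices, with the same definition of $\mathbf{S}$ using $p_j=1/n$. *)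

(* Defs.v *)
From HB Require Import structures.
From mathcomp Require Import all_boot all_order all_algebra.
From mathcomp Require Import all_classical all_reals all_analysis.
From mathcomp Require Import complex.

Set Implicit Arguments.
Unset Strict Implicit.
Unset Printing Implicit Defensive.

Import Order.TTheory GRing.Theory Num.Theory.

Local Open Scope classical_set_scope.
Local Open Scope ring_scope.

(* The library norm on matrices is the max norm, hence these two. *)
Definition two_norm (R : realType) (m : nat) (x : 'cV[R]_m) : R :=
  Num.sqrt (\sum_(i < m) x i 0 ^+ 2).

Definition frobenius_norm (R : realType) (m n : nat) (A : 'M[R]_(m, n)) : R :=
  Num.sqrt (\sum_(i < m) \sum_(j < n) A i j ^+ 2).

(* The terms are nonnegative, so the default value 0 of the maximum is
   harmless when n > 0. *)
Definition coherence (R : realType) (m n : nat) (Q : 'M[R]_(m, n)) : R :=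
  \big[Num.max/0]_(j < n) two_norm (col j Q) ^+ 2.

(* [inf] is the infimum in R; on symmetric matrices of positive size it is
   a minimum by [smallest_eigenvalueP]. *)
Definition smallest_eigenvalue (R : realType) (m : nat) (A : 'M[R]_m) : R :=
  inf [set a : R | eigenvalue A a].

Lemma symmetric_has_eigenvalue (R : realType) (m : nat) (A : 'M[R]_m) :
  (0 < m)%N -> A^T = A -> exists a, eigenvalue A a.
Proof.
move=> m_gt0 AT; pose f : {rmorphism R -> R[i]} := real_complex R.
have /closed_rootP[z] : size (map_poly f (char_poly A)) != 1%N.
  by rewrite size_map_poly size_char_poly; case: m m_gt0 A AT.
rewrite map_char_poly -eigenvalue_root_char => /eigenvalueP[v vA v0].
pose w := map_mx Num.conj v.
have Af : (map_mx f A)^T = map_mx f A by apply/matrixP => i j; rewrite -[in RHS]AT !mxE.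
have wA : w *m map_mx f A = z^* *: w.
  rewrite -map_mxZ -vA map_mxM; congr (_ *m _).
  apply/matrixP => i j; rewrite !mxE; apply/esym/CrealP.
  by rewrite complex_real.
have : z *: (v *m w^T) = z^* *: (v *m w^T).
  by rewrite scalemxAl -vA -mulmxA -[map_mx f A]Af -trmx_mul wA linearZ /= -scalemxAr.
move/matrixP/(_ 0 0); rewrite !mxE => /mulIf zz.
have : z = z^*.
  apply: zz; rewrite psumr_eq0.
    apply: contra v0 => /allP h; apply/eqP/rowP => j; rewrite mxE.
    have := h j (mem_index_enum _).
    by rewrite !mxE mul_conjC_eq0 => /eqP.
  by move=> j _; rewrite !mxE mul_conjC_ge0.
move/esym/CrealP/complex_realP => [a za].
exists a; rewrite eigenvalue_root_char -(fmorph_root f) map_char_poly.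
rewrite -eigenvalue_root_char -[f a]za; apply/eigenvalueP; by exists v.
Qed.

Lemma smallest_eigenvalueP (R : realType) (m : nat) (A : 'M[R]_m) :
  (0 < m)%N -> A^T = A ->
  eigenvalue A (smallest_eigenvalue A) /\
  forall a, eigenvalue A a -> smallest_eigenvalue A <= a.
Proof.
move=> m_gt0 AT; have [a0 ea0] := symmetric_has_eigenvalue m_gt0 AT.
have [s defs] := closed_field_poly_normal (map_poly (real_complex R) (char_poly A)).
pose r := [seq b <- map (@complex.Re R) s | eigenvalue A b].
have rE a : (a \in r) = eigenvalue A a.
  rewrite mem_filter andb_idr // eigenvalue_root_char.
  rewrite -(fmorph_root (real_complex R)) /= defs rootZ; last first.
    by rewrite lead_coef_eq0 map_poly_eq0 monic_neq0 // char_poly_monic.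
  by rewrite root_prod_XsubC => /(map_f (@complex.Re R)).
have [b rb bmin] : exists2 b, b \in r & forall a, a \in r -> b <= a.
  have: r != [::] by apply: contraTneq ea0 => r0; rewrite -rE r0.
  elim: (r) => // x [|y l] IH _.
    by exists x => [|a]; rewrite ?inE// => /eqP ->.
  have [//|b bl bmin] := IH; have [xb|bx] := leP x b.
    exists x => [|a]; first by rewrite inE eqxx.
    by rewrite inE => /orP[/eqP->//|/bmin]; apply: le_trans.
  exists b => [|a]; first by rewrite inE bl orbT.
  by rewrite inE => /orP[/eqP->|/bmin//]; apply: ltW.
suff -> : smallest_eigenvalue A = b.
  by split=> [|a]; rewrite -rE //; apply: bmin.
apply/eqP; rewrite eq_le; apply/andP; split.
  by apply: ge_inf; [exists b => a /=; rewrite -rE; apply: bmin | rewrite /= -rE].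
by apply: lb_le_inf; [exists a0 | move=> a /=; rewrite -rE; apply: bmin].
Qed.

(* The m-th largest singular value of an m x c matrix; it is 0 when c < m. *)
Definition sigma_m (R : realType) (m c : nat) (A : 'M[R]_(m, c)) : R :=
  Num.sqrt (smallest_eigenvalue (A *m A^T)).

Definition c1 (R : realType) (eps : R) : R :=
  eps ^+ 2 / ((1 - eps) * ln (1 - eps) + eps).

Definition is_distribution (R : realType) (n : nat) (p : 'I_n -> R) : Prop :=
  (forall i, 0 <= p i) /\ \sum_(i < n) p i = 1.

Definition uniform_distribution (R : realType) (n : nat) : 'I_n -> R :=
  fun=> n%:R^-1.

Definition nearly_optimal (R : realType) (m n : nat) (Q : 'M[R]_(m, n))
    (beta : R) (p : 'I_n -> R) : Prop :=
  is_distribution p /\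
  forall j, beta * two_norm (col j Q) ^+ 2 / frobenius_norm Q ^+ 2 <= p j.

(* Column j is e_(t j) / sqrt (c * p (t j)). If p (t j) = 0 it is 0 by the
   convention 0^-1 = 0, but such indices are drawn with probability 0. *)
Definition sampling_matrix (R : realType) (n c : nat) (p : 'I_n -> R)
    (t : 'I_c -> 'I_n) : 'M[R]_(n, c) :=
  \matrix_(i < n, j < c) ((1%:M : 'M[R]_n) i (t j) / Num.sqrt (c%:R * p (t j))).

Definition random_indices d (T : measurableType d) (n c : nat)
    (t : 'I_c -> T -> 'I_n) : Prop :=
  forall j i, measurable [set w | t j w = i].

Definition mutually_independent d (T : measurableType d) (R : realType)
    (P : probability T R) (n c : nat) (t : 'I_c -> T -> 'I_n) : Prop :=
  forall (J : {set 'I_c}) (A : 'I_c -> set 'I_n),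
    P [set w | forall j, j \in J -> A j (t j w)] =
    (\prod_(j in J) P [set w | A j (t j w)])%E.

Definition sampled_with_replacement d (T : measurableType d) (R : realType)
    (P : probability T R) (n c : nat) (p : 'I_n -> R)
    (t : 'I_c -> T -> 'I_n) : Prop :=
  [/\ random_indices t,
      forall j i, P [set w | t j w = i] = (p i)%:E
    & mutually_independent P t].

(* (t_1, ..., t_c) is uniform on the n ^_ c sequences of distinct indices. *)
Definition sampled_without_replacement d (T : measurableType d) (R : realType)
    (P : probability T R) (n c : nat) (t : 'I_c -> T -> 'I_n) : Prop :=
  random_indices t /\
  forall s : {ffun 'I_c -> 'I_n},
    P [set w | forall j, t j w = s j] =
    (if injectiveb s then ((n ^_ c)%:R^-1)%:E else 0%E).

(* Main.v *)
Require Import Defs.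
From mathcomp Require Import all_boot all_order all_algebra.
From mathcomp Require Import all_classical all_reals all_analysis.
From mathcomp Require Import fingroup perm ring lra zify.

Set Implicit Arguments.
Unset Strict Implicit.
Unset Printing Implicit Defensive.

Import Order.TTheory GRing.Theory Num.Theory.

Local Open Scope classical_set_scope.
Local Open Scope ring_scope.

(** The proof is a matrix Chernoff bound by the Laplace transform method,
    carried out with matrix powers instead of matrix exponentials.

    The Gram matrix of the sketch is a sum Y of c random rank-one matrices
    X_i = x_i x_i^T, whose mean is 1/c times the identity, and which satisfy
    |x_i|^2 <= L with L = K / c; here K = m / beta for nearly optimal
    probabilities and K = n mu for uniform ones. If Y has an eigenvalue at
    most 1 - eps, then tr exp (theta (1 - eps) - theta Y) >= 1, so by Markov's
    inequality the failure probability is at most the mean of this trace.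

    For independent draws the mean is bounded one draw at a time. The
    Golden-Thompson inequality splits a draw off,
    tr exp (A - theta X_i) <= tr (exp A exp (- theta X_i)), and as X_i has rank
    one and its mean is a multiple of the identity, averaging over i multiplies
    the trace by at most exp (- (1 - exp (- theta L)) / (L c)). With
    theta = - ln (1 - eps) / L the result is
    m exp (- ((1 - eps) ln (1 - eps) + eps) / L), and the assumed lower bound
    on c makes this at most delta.

    Throughout, exp A is replaced by (1 + A / N)^N with N = 2^k. For such
    exponents the trace inequalities have short proofs by repeated use of the
    Cauchy-Schwarz (here arithmetic-geometric mean) inequality for the
    Frobenius inner product: [golden_thompson_dyadic] and the convexity
    [mxtrace_expr_convex]. The price is that the draw is split off only up to
    an error O(1 / N), as 1 + (A + B) / N and (1 + A / N)(1 + B / N) differ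
    ([mxtrace_exprD_le]); the bad event still forces the trace to be at least 1
    for every N, so N may tend to infinity in the final scalar inequality
    ([chernoff_lower_tail]).

    Sampling without replacement reduces to sampling with replacement by
    Hoeffding's comparison ([hoeffding_comparison]): the mean of a convex
    function of a sum of draws is no larger without replacement. *)

(** * Trace inequalities for dyadic powers *)

Section TraceInequalities.
Variables (R : realFieldType) (m : nat).
Implicit Types A B C D M Z : 'M[R]_m.

Lemma trmxM A B : (A * B)^T = B^T * A^T.
Proof. exact: trmx_mul. Qed.

Lemma trmxX A k : (A ^+ k)^T = A^T ^+ k.
Proof.
elim: k => [|k IH]; first by rewrite !expr0 trmx1.
by rewrite exprS trmxM IH exprSr.
Qed.

Lemma mxtraceC A B : \tr (A * B) = \tr (B * A).
Proof. exact: mxtrace_mulC. Qed.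

Lemma mxtrace_mul_trmx_ge0 A : 0 <= \tr (A * A^T).
Proof.
apply: sumr_ge0 => i _; rewrite mxE; apply: sumr_ge0 => j _.
by rewrite mxE -expr2 sqr_ge0.
Qed.

Lemma mxtrace_sqr_ge0 A : A^T = A -> 0 <= \tr (A ^+ 2).
Proof. by move=> As; rewrite expr2 -{2}As mxtrace_mul_trmx_ge0. Qed.

Lemma mxtrace_expr_even_ge0 A k : A^T = A -> 0 <= \tr (A ^+ k.*2).
Proof.
by move=> As; rewrite -muln2 exprM mxtrace_sqr_ge0// trmxX As.
Qed.

(** The trace of (A - B^T)(A - B^T)^T is nonnegative. All the trace
    inequalities below rest on this form of the Cauchy-Schwarz inequality. *)
Lemma mxtrace_amgm A B :
  2 * \tr (A * B) <= \tr (A * A^T) + \tr (B^T * B).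
Proof.
have := mxtrace_mul_trmx_ge0 (A - B^T).
rewrite linearB /= trmxK mulrBl !mulrBr !linearB /= -trmxM mxtrace_tr.
lra.
Qed.

Lemma mxtrace_sqr_le Z : \tr (Z * Z) <= \tr (Z * Z^T).
Proof. by have := mxtrace_amgm Z Z; rewrite [\tr (Z^T * _)]mxtraceC; lra. Qed.

Lemma mxtrace_sym_amgm A B : A^T = A -> B^T = B ->
  2 * \tr (A * B) <= \tr (A ^+ 2) + \tr (B ^+ 2).
Proof. by move=> As Bs; have := mxtrace_amgm A B; rewrite As Bs -!expr2. Qed.

(** A power of AB is a cyclic word, and the trace does not see where a cyclic
    word starts. *)
Lemma mxtrace_exprM_rot A B k : \tr ((A * B) ^+ k) = \tr ((B * A) ^+ k).
Proof.
case: k => [|k]; first by rewrite !expr0.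
have rot : forall j, (A * B) ^+ j * A = A * (B * A) ^+ j.
  elim=> [|j IH]; first by rewrite !expr0 mul1r mulr1.
  by rewrite exprS -mulrA IH exprS !mulrA.
by rewrite exprSr mulrA rot -mulrA mxtraceC -mulrA -exprSr.
Qed.

(** The two families of inequalities feed each other. The second one doubles
    its exponent by applying the first to Z = CD, because ZZ^T = C D^2 C is a
    rotation of C^2 D^2. The first one doubles its exponent by applying itself to
    Z^2, which leaves a power of (Z^T Z)(Z Z^T); the second inequality and
    Cauchy-Schwarz then finish, as Z^T Z and Z Z^T have powers of equal trace. *)
Lemma golden_thompson_dyadic_aux k :
  (forall Z, \tr (Z ^+ (2 ^ k.+1)) <= \tr ((Z * Z^T) ^+ (2 ^ k))) /\
  (forall C D, C^T = C -> D^T = D ->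
     \tr ((C * D) ^+ (2 ^ k)) <= \tr (C ^+ (2 ^ k) * D ^+ (2 ^ k))).
Proof.
elim: k => [|k [IHZ IHCD]].
  by split=> [Z|C D _ _]; rewrite !expr1 // expr2 mxtrace_sqr_le.
split=> [Z|C D Cs Ds]; rewrite [in leLHS]expnS exprM.
  apply: le_trans (IHZ _) _.
  have -> : Z ^+ 2 * (Z ^+ 2)^T = Z * ((Z * Z^T) * Z^T).
    by rewrite !expr2 trmxM !mulrA.
  rewrite mxtrace_exprM_rot -mulrA.
  have Zs1 : (Z * Z^T)^T = Z * Z^T by rewrite trmxM trmxK.
  have Zs2 : (Z^T * Z)^T = Z^T * Z by rewrite trmxM trmxK.
  apply: le_trans (IHCD _ _ Zs1 Zs2) _.
  have := @mxtrace_sym_amgm ((Z * Z^T) ^+ (2 ^ k)) ((Z^T * Z) ^+ (2 ^ k)).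
  rewrite !trmxX Zs1 Zs2 -!exprM -!expnSr.
  rewrite [\tr ((Z^T * Z) ^+ _)]mxtrace_exprM_rot => /(_ erefl erefl); lra.
rewrite -exprM -expnS.
apply: le_trans (IHZ _) _.
rewrite trmxM Cs Ds -mulrA mxtrace_exprM_rot.
have -> : D * (D * C) * C = D ^+ 2 * C ^+ 2 by rewrite !expr2 !mulrA.
rewrite mxtrace_exprM_rot.
apply: le_trans (IHCD _ _ _ _) _; rewrite ?trmxX ?Cs ?Ds //.
by rewrite -!exprM -!expnS.
Qed.

(** With C = 1 + A / N and D = 1 + B / N, where N = 2^k, this tends to the
    Golden-Thompson inequality tr exp (A + B) <= tr (exp A exp B) as k grows. *)
Lemma golden_thompson_dyadic k C D : C^T = C -> D^T = D ->
  \tr ((C * D) ^+ (2 ^ k)) <= \tr (C ^+ (2 ^ k) * D ^+ (2 ^ k)).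
Proof. by case: (golden_thompson_dyadic_aux k) => _; apply. Qed.

(** The tangent line inequality for the convex function tr A^N at M, in Young's
    form. With N = 2p, Cauchy-Schwarz bounds 2 tr (M^p M^(p-1) A) by tr M^N +
    tr (M^(N-2) A^2), whose last term is the induction hypothesis for M^2, A^2. *)
Lemma mxtrace_young_dyadic k M A : (0 < k)%N -> M^T = M -> A^T = A ->
  (2 ^ k)%:R * \tr (M ^+ (2 ^ k).-1 * A) <=
  (2 ^ k).-1%:R * \tr (M ^+ (2 ^ k)) + \tr (A ^+ (2 ^ k)).
Proof.
elim: k M A => // -[|k] IH M A _ Ms As.
  have := mxtrace_sym_amgm Ms As; rewrite !expr1 mul1r; lra.
have k0 : (0 < 2 ^ k.+1)%N by rewrite expn_gt0.
have eS : (2 ^ k.+2).-1 = ((2 ^ k.+1).-1 + 2 ^ k.+1)%N.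
  by rewrite expnS mul2n -addnn -{1}(prednK k0) addSn.
set p := (2 ^ k.+1)%N in k0 eS *.
have e2 : (2 ^ k.+2 = 2 * p)%N by rewrite expnS.
have := IH (M ^+ 2) (A ^+ 2) isT; rewrite !trmxX Ms As -/p => /(_ erefl erefl).
rewrite -!exprM.
have := mxtrace_amgm (M ^+ p) (M ^+ p.-1 * A).
rewrite trmxM !trmxX Ms As -exprD addnn -mul2n !mulrA -exprD.
have -> : \tr (A * M ^+ p.-1 * M ^+ p.-1 * A) = \tr (M ^+ (2 * p.-1) * A ^+ 2).
  by rewrite -mulrA -mulrA mxtraceC mulrA -exprD addnn -mul2n -mulrA -expr2.
have -> : (p + p.-1)%N = (2 ^ k.+2).-1 by rewrite eS addnC.
rewrite -e2 => h1 h2.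
have -> : (2 ^ k.+2)%:R = 2 * p%:R :> R by rewrite e2 natrM.
have -> : (2 ^ k.+2).-1%:R = 2 * p%:R - 1 :> R.
  by rewrite eS natrD -{2}(prednK k0) -{3}(prednK k0) -natr1; ring.
have e3 : p.-1%:R = p%:R - 1 :> R by rewrite -{2}(prednK k0) -natr1; ring.
rewrite e3 -mulrA -expr2 in h2.
have p_ge0 : 0 <= p%:R :> R by exact: ler0n.
have := ler_wpM2l p_ge0 h1; lra.
Qed.

(** Two tangent lines, at the point M of the segment, are averaged; since their
    linear terms add up to N tr M^N, the value at M is bounded by the average of
    the values at the ends. *)
Lemma mxtrace_expr_convex k A B (l : R) : (0 < k)%N -> A^T = A -> B^T = B ->
  0 <= l <= 1 ->
  \tr ((l *: A + (1 - l) *: B) ^+ (2 ^ k)) <=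
  l * \tr (A ^+ (2 ^ k)) + (1 - l) * \tr (B ^+ (2 ^ k)).
Proof.
move=> k0 As Bs /andP[l0 l1]; set M := _ + _.
have Ms : M^T = M by rewrite /M linearD /= !linearZ /= As Bs.
have := mxtrace_young_dyadic k0 Ms As.
have := mxtrace_young_dyadic k0 Ms Bs.
have N0 : (0 < 2 ^ k)%N by rewrite expn_gt0.
have -> : \tr (M ^+ (2 ^ k)) =
    l * \tr (M ^+ (2 ^ k).-1 * A) + (1 - l) * \tr (M ^+ (2 ^ k).-1 * B).
  rewrite -{1}(prednK N0) exprSr {2}/M -!mulmxE mulmxDr linearD /=.
  by rewrite -!scalemxAr !linearZ.
have -> : (2 ^ k)%:R = (2 ^ k).-1%:R + 1 :> R by rewrite natr1 prednK.
move: (\tr _) (\tr _) (\tr _) (\tr _) => a b c d h1 h2.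
have l1' : 0 <= 1 - l by lra.
have := ler_wpM2l l0 h2; have := ler_wpM2l l1' h1; lra.
Qed.
End TraceInequalities.

(** * Perturbation of large powers *)

Section RowSumBound.
Variables (R : realFieldType) (m : nat).
Implicit Types A B U V : 'M[R]_m.

(** The operator norm for the supremum norm, as a predicate. The identity has
    norm 1 here, so that powers of 1 + A / N stay bounded as N grows; this fails
    for the Frobenius norm. *)
Definition rowsum_le A (a : R) := forall i, \sum_j `|A i j| <= a.

Lemma rowsum_le1 : rowsum_le 1 1.
Proof.
move=> i; rewrite (bigD1 i) //= mxE eqxx normr1 big1 ?addr0// => j ji.
by rewrite mxE eq_sym (negbTE ji) normr0.
Qed.

Lemma rowsum_leD A B a b :
  rowsum_le A a -> rowsum_le B b -> rowsum_le (A + B) (a + b).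
Proof.
move=> Aa Bb i; apply: le_trans (lerD (Aa i) (Bb i)).
by rewrite -big_split; apply: ler_sum => j _; rewrite mxE ler_normD.
Qed.

Lemma rowsum_leZ A a (c : R) : rowsum_le A a -> rowsum_le (c *: A) (`|c| * a).
Proof.
move=> Aa i; apply: le_trans (ler_wpM2l (normr_ge0 c) (Aa i)).
by rewrite mulr_sumr; apply: ler_sum => j _; rewrite mxE normrM.
Qed.

Lemma rowsum_leM A B a b : 0 <= b ->
  rowsum_le A a -> rowsum_le B b -> rowsum_le (A * B) (a * b).
Proof.
move=> b0 Aa Bb i; apply: le_trans (ler_wpM2r b0 (Aa i)).
apply: (@le_trans _ _ (\sum_j \sum_k `|A i k| * `|B k j|)).
  apply: ler_sum => j _; rewrite mxE; apply: le_trans (ler_norm_sum _ _ _) _.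
  by apply: ler_sum => k _; rewrite normrM.
rewrite exchange_big mulr_suml; apply: ler_sum => k _.
by rewrite -mulr_sumr ler_wpM2l.
Qed.

Lemma rowsum_leW A a b : a <= b -> rowsum_le A a -> rowsum_le A b.
Proof. by move=> ab Aa i; apply: le_trans ab. Qed.

Lemma rowsum_leX A a k : 0 <= a -> rowsum_le A a -> rowsum_le (A ^+ k) (a ^+ k).
Proof.
move=> a0 Aa; elim: k => [|k IH]; first exact: rowsum_le1.
by rewrite !exprSr; apply: rowsum_leM.
Qed.

Lemma rowsum_le_family (I : finType) (F : I -> 'M[R]_m) :
  exists2 a, 0 <= a & forall i, rowsum_le (F i) a.
Proof.
exists (\sum_i \sum_j \sum_k `|F i j k|).
  by do 2 (apply: sumr_ge0 => ? _); apply: sumr_ge0.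
move=> i j; rewrite [leRHS](bigD1 i) //= [in leRHS](bigD1 j) //= -addrA lerDl.
rewrite addr_ge0// !sumr_ge0// => *; rewrite !sumr_ge0// => *.
by rewrite sumr_ge0.
Qed.

Lemma mxtrace_rowsum_le A a : rowsum_le A a -> \tr A <= m%:R * a.
Proof.
move=> Aa; rewrite mulr_natl -[X in _ *+ X]card_ord -sumr_const.
apply: ler_sum => i _; apply: le_trans (Aa i).
by rewrite (bigD1 i) //= (le_trans (ler_norm _))// lerDl sumr_ge0.
Qed.

(** Telescoping: V^(k+1) - U^(k+1) = V^k (V - U) + (V^k - U^k) U. *)
Lemma rowsum_le_subX U V r e k : 1 <= r -> 0 <= e ->
  rowsum_le U r -> rowsum_le V r -> rowsum_le (V - U) e ->
  rowsum_le (V ^+ k - U ^+ k) (k%:R * e * r ^+ k).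
Proof.
move=> r1 e0 Ur Vr VUe; have r0 : 0 <= r by apply: le_trans r1.
elim: k => [|k IH].
  by move=> i; rewrite !expr0 subrr !mul0r big1// => j _; rewrite mxE normr0.
have -> : V ^+ k.+1 - U ^+ k.+1 = V ^+ k * (V - U) + (V ^+ k - U ^+ k) * U.
  by rewrite mulrBr mulrBl !exprSr addrA subrK.
have rk : 0 <= r ^+ k by apply: exprn_ge0.
apply: rowsum_leW (rowsum_leD (rowsum_leM e0 (rowsum_leX k r0 Vr) VUe)
                              (rowsum_leM r0 IH Ur)).
have := ler_wpM2l (mulr_ge0 e0 rk) r1; rewrite exprSr -natr1; lra.
Qed.

End RowSumBound.

Lemma expr_1Ddivn_le (R : realType) (a : R) (N : nat) : (0 < N)%N ->
  0 <= 1 + a / N%:R -> (1 + a / N%:R) ^+ N <= expR a.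
Proof.
move=> N0 h; apply: (@le_trans _ _ (expR (a / N%:R) ^+ N)).
  by apply: lerXn2r; rewrite ?nnegrE ?expR_ge0// expR_ge1Dx.
by rewrite -expRM_natl mulrC divfK// pnatr_eq0 -lt0n.
Qed.

(** The product (1 + A / N)(1 + B / N) exceeds 1 + (A + B) / N by AB / N^2, so
    their N-th powers differ by O(1 / N), and the dyadic Golden-Thompson
    inequality applies to the product. The constant in the error term depends
    only on bounds for A and B, which makes the errors of successive draws add up. *)
Lemma mxtrace_exprD_le (R : realType) (m k : nat) (A B : 'M[R]_m) (a b : R) :
  0 <= a -> 0 <= b -> A^T = A -> B^T = B -> rowsum_le A a -> rowsum_le B b ->
  \tr ((1 + (2 ^ k)%:R^-1 *: (A + B)) ^+ (2 ^ k)) <=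
  \tr ((1 + (2 ^ k)%:R^-1 *: A) ^+ (2 ^ k) *
       (1 + (2 ^ k)%:R^-1 *: B) ^+ (2 ^ k))
    + m%:R * (a * b * expR (a + b)) / (2 ^ k)%:R.
Proof.
move=> a0 b0 As Bs Aa Bb; set N := (2 ^ k)%N; set u := N%:R^-1.
have N0 : (0 < N)%N by rewrite expn_gt0.
have u0 : 0 < u by rewrite invr_gt0 ltr0n.
have As' : (1 + u *: A)^T = 1 + u *: A by rewrite linearD /= linearZ /= As trmx1.
have Bs' : (1 + u *: B)^T = 1 + u *: B by rewrite linearD /= linearZ /= Bs trmx1.
have := golden_thompson_dyadic k As' Bs'.
rewrite -/N; set V := 1 + u *: (A + B); set U := (_ * _ : 'M[R]_m).
have UE : U = V + u ^+ 2 *: (A * B).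
  rewrite /U /V mulrDl mul1r mulrDr mulr1 scalerDr -!addrA; congr (_ + _).
  rewrite addrCA; congr (_ + (_ + _)).
  by rewrite -!mulmxE -scalemxAl -scalemxAr scalerA expr2.
(* This r bounds both U and V, and r ^+ N <= expR (a + b). *)
set r := (1 + a / N%:R) * (1 + b / N%:R).
have ra : 1 <= 1 + a / N%:R by rewrite lerDl divr_ge0.
have rb : 1 <= 1 + b / N%:R by rewrite lerDl divr_ge0.
have r1 : 1 <= r by rewrite /r -[leLHS]mulr1 ler_pM.
have scal (X : 'M[R]_m) x : rowsum_le X x -> rowsum_le (u *: X) (x / N%:R).
  by move=> /(rowsum_leZ u); rewrite gtr0_norm// mulrC.
have Ur : rowsum_le U r.
  have rb0 : 0 <= 1 + b / N%:R by lra.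
  exact: rowsum_leM rb0 (rowsum_leD (@rowsum_le1 _ _) (scal _ _ Aa))
                        (rowsum_leD (@rowsum_le1 _ _) (scal _ _ Bb)).
have Vr : rowsum_le V r.
  apply: (@rowsum_leW _ _ _ (1 + `|u| * (a + b))); last first.
    by apply: rowsum_leD (@rowsum_le1 _ _) _; apply/rowsum_leZ/rowsum_leD.
  rewrite (gtr0_norm u0) /r -/u.
  have : 0 <= (a * u) * (b * u) by rewrite !mulr_ge0// ltW.
  lra.
have e0 : 0 <= u ^+ 2 * (a * b) by rewrite !mulr_ge0// ltW.
have VUe : rowsum_le (V - U) (u ^+ 2 * (a * b)).
  have -> : V - U = (- u ^+ 2) *: (A * B).
    by rewrite UE opprD addrA subrr add0r scaleNr.
  rewrite -[X in X * (a * b)]gtr0_norm ?exprn_gt0// -normrN.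
  by apply/rowsum_leZ/rowsum_leM.
have := mxtrace_rowsum_le (rowsum_le_subX N r1 e0 Ur Vr VUe).
rewrite linearB /= lerBlDl => h1 h2.
have rN : r ^+ N <= expR (a + b).
  rewrite /r exprMn expRD ler_pM ?exprn_ge0 ?expr_1Ddivn_le//; lra.
have h3 : m%:R * (N%:R * (u ^+ 2 * (a * b)) * r ^+ N) <=
    m%:R * (a * b * expR (a + b)) / N%:R.
  rewrite -/u -[leRHS]mulrA ler_wpM2l//.
  have -> : N%:R * (u ^+ 2 * (a * b)) = a * b * u.
    by rewrite expr2 !mulrA mulfV ?mul1r ?pnatr_eq0 -?lt0n//; ring.
  by rewrite [leLHS]mulrAC ler_wpM2r ?(ltW u0)// ler_wpM2l// mulr_ge0.
by apply: le_trans h1 _; exact: lerD.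
Qed.

(** * Rank-one matrices and lists of draws *)

Section FfunCons.
Variables (T : finType) (c : nat).

Definition ffun_cons (i : T) (s : {ffun 'I_c -> T}) : {ffun 'I_c.+1 -> T} :=
  [ffun j => oapp s i (unlift ord0 j)].

Lemma ffun_cons0 i s : ffun_cons i s ord0 = i.
Proof. by rewrite ffunE unlift_none. Qed.

Lemma ffun_consS i s j : ffun_cons i s (lift ord0 j) = s j.
Proof. by rewrite ffunE liftK. Qed.

Lemma big_ffun_cons (V : nmodType) (F : {ffun 'I_c.+1 -> T} -> V) :
  \sum_s F s = \sum_i \sum_s F (ffun_cons i s).
Proof.
rewrite pair_big /= (reindex (fun u => ffun_cons u.1 u.2)) //=.
exists (fun s : {ffun 'I_c.+1 -> T} => (s ord0, [ffun j => s (lift ord0 j)])).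
  move=> [i s] _ /=; rewrite ffun_cons0; congr pair.
  by apply/ffunP => j; rewrite ffunE ffun_consS.
move=> s _; apply/ffunP => j /=; rewrite ffunE.
by case: unliftP => [j' ->|->] //=; rewrite ffunE.
Qed.
End FfunCons.

(** A convex function lies below its chord, here on the segment from 0 to L. *)
Lemma expRN_chord (R : realType) (theta l L : R) : 0 < L -> 0 <= l <= L ->
  expR (- (theta * l)) <= 1 - l / L * (1 - expR (- (theta * L))).
Proof.
move=> L0 /andP[l0 lL].
have tP : 0 <= l / L <= 1 by rewrite divr_ge0 ?(ltW L0)// ler_pdivrMr// mul1r.
have := @convex_expR R (Itv01 (andP tP).1 (andP tP).2) (- (theta * L)) 0.
rewrite !convRE /= /unstable.onem mulr0 addr0 expR0 mulr1.
have -> : l / L * - (theta * L) = - (theta * l).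
  by rewrite mulrN mulrCA divfK ?gt_eqF.
lra.
Qed.

Section RankOne.
Variables (R : realType) (m : nat).
Implicit Types (x : 'cV[R]_m) (W H : 'M[R]_m).

Definition outer x : 'M[R]_m := x *m x^T.
Definition sqnorm x : R := \tr (outer x).

Lemma outer_sym x : (outer x)^T = outer x.
Proof. by rewrite trmx_mul trmxK. Qed.

Lemma sqnormE x : sqnorm x = \sum_i x i 0 ^+ 2.
Proof.
apply: eq_bigr => i _; rewrite !mxE big_ord1 mxE.
by rewrite expr2.
Qed.

Lemma sqnorm_ge0 x : 0 <= sqnorm x.
Proof. by rewrite sqnormE sumr_ge0// => i _; rewrite sqr_ge0. Qed.

Lemma sqnorm_eq0 x : sqnorm x = 0 -> x = 0.
Proof.
rewrite sqnormE => /eqP; rewrite psumr_eq0; last by move=> i _; rewrite sqr_ge0.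
move=> /allP h; apply/colP => i; rewrite mxE; apply/eqP.
by have := h i (mem_index_enum _); rewrite sqrf_eq0.
Qed.

Lemma outer_sqr x : outer x * outer x = sqnorm x *: outer x.
Proof.
rewrite /outer -mulmxE mulmxA -(mulmxA x) [_^T *m x]mx11_scalar.
rewrite mul_mx_scalar -scalemxAl; congr (_ *: _).
by rewrite sqnormE mxE; apply: eq_bigr => i _; rewrite mxE expr2.
Qed.

(** The powers of 1 - t xx^T stay in the span of 1 and xx^T, since
    (xx^T)^2 = |x|^2 xx^T; the coefficient g is determined by the eigenvalue
    (1 - t |x|^2)^N at x, unless x = 0. *)
Lemma rank_one_exp x (t : R) N : exists2 g,
  (1 - t *: outer x) ^+ N = 1 - g *: outer x &
  g * sqnorm x = 1 - (1 - t * sqnorm x) ^+ N.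
Proof.
elim: N => [|N [g gE gs]].
  by exists 0; rewrite ?expr0 ?scale0r ?subr0// mul0r subrr.
exists (g + t - g * t * sqnorm x); last by rewrite exprS; ring: gs.
rewrite exprSr gE mulrBl mul1r mulrBr mulr1.
rewrite -!mulmxE -scalemxAl -scalemxAr mulmxE outer_sqr !scalerA.
by rewrite scalerBl scalerDl; rewrite !opprB !opprD [LHS]addrAC !addrA.
Qed.

(** Along x, the power has eigenvalue at most exp (- theta |x|^2), which the
    chord inequality bounds linearly in |x|^2. The factor in front of
    tr (W xx^T) is thus the same for all x with |x|^2 <= L, and averaging over
    random x only involves the mean of xx^T. *)
Lemma rank_one_step x W (theta L : R) N : 0 < L -> sqnorm x <= L -> 0 <= theta ->
  (0 < N)%N -> theta * L <= N%:R -> 0 <= \tr (W * outer x) ->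
  \tr (W * (1 - (N%:R^-1 * theta) *: outer x) ^+ N) <=
  \tr W - (1 - expR (- (theta * L))) / L * \tr (W * outer x).
Proof.
move=> L0 xL th0 N0 NL Wx0.
have [g -> gs] := rank_one_exp x (N%:R^-1 * theta) N.
rewrite mulrBr mulr1 linearB /= -mulmxE -scalemxAr linearZ /= mulmxE lerB//.
have := sqnorm_ge0 x; rewrite le_eqVlt => /predU1P[/esym x0|x_gt0].
  have -> : outer x = 0 by rewrite (sqnorm_eq0 x0) /outer mul0mx.
  by rewrite mulr0 mxtrace0 !mulr0.
apply: ler_wpM2r => //; rewrite -(ler_pM2r x_gt0) gs.
have := @expRN_chord R theta (sqnorm x) L L0; rewrite xL ltW// => /(_ isT) h1.
have NR0 : 0 < N%:R :> R by rewrite ltr0n.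
have := @expr_1Ddivn_le R (- (theta * sqnorm x)) N N0.
have -> : 1 + - (theta * sqnorm x) / N%:R = 1 - N%:R^-1 * theta * sqnorm x.
  by ring.
have h2 : 0 <= 1 - N%:R^-1 * theta * sqnorm x.
  rewrite subr_ge0 -mulrA mulrC ler_pdivrMr// mul1r (le_trans _ NL)//.
  exact: ler_wpM2l.
move=> /(_ h2) h3; rewrite mulrAC [X in X * _ <= _]mulrC.
have : (1 - expR (- (theta * L))) * sqnorm x / L =
    sqnorm x / L * (1 - expR (- (theta * L))) by ring.
lra.
Qed.

Lemma mxtrace_sqr_outer_ge0 H x : H^T = H -> 0 <= \tr (H ^+ 2 * outer x).
Proof.
move=> Hs; have -> : \tr (H ^+ 2 * outer x) = sqnorm (H *m x).
  rewrite /sqnorm /outer trmx_mul Hs expr2 -mulrA mxtraceC -!mulmxE.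
  by rewrite !mulmxA.
exact: sqnorm_ge0.
Qed.

End RankOne.

(** * The mean trace over independent draws *)

Section Draws.
Variables (R : realType) (m n : nat) (x : 'I_n -> 'cV[R]_m) (p : 'I_n -> R).
Variables (theta L c : R) (b : R).
Hypotheses (p_distr : is_distribution p) (theta_ge0 : 0 <= theta) (L_gt0 : 0 < L).
Hypotheses (c_gt0 : 0 < c) (x_le : forall i, sqnorm (x i) <= L).
Hypothesis x_mean : \sum_i p i *: outer (x i) = c^-1%:M.
Hypotheses (b_ge0 : 0 <= b) (xb : forall i, rowsum_le (- theta *: outer (x i)) b).
Implicit Types A : 'M[R]_m.

(** An approximation of tr exp A that avoids matrix exponentials and satisfies
    the trace inequalities for dyadic powers. *)
Definition trexp k A : R := \tr ((1 + (2 ^ k)%:R^-1 *: A) ^+ (2 ^ k)).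

(** The error numerator of [mxtrace_exprD_le], for matrices with row sums at
    most a and b. *)
Definition slack (a : R) : R := m%:R * (a * b * expR (a + b)).

(** The factor by which one draw shrinks the mean trace. It bounds
    1 - (1 - exp (- theta L)) / (L c), and being an exponential it is visibly
    nonnegative. *)
Definition decay : R := expR (- ((1 - expR (- (theta * L))) / (L * c))).

Lemma slack_ge0 a : 0 <= a -> 0 <= slack a.
Proof. by move=> a0; rewrite /slack !mulr_ge0// expR_ge0. Qed.

Lemma slack_mono a a' : 0 <= a -> a <= a' -> slack a <= slack a'.
Proof.
move=> a0 aa'; apply: ler_wpM2l => //; apply: ler_pM => //.
- exact: mulr_ge0.
- exact: ler_wpM2r.
- by rewrite ler_expR lerD2r.
Qed.

Lemma trexp_ge0 k A : (0 < k)%N -> A^T = A -> 0 <= trexp k A.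
Proof.
case: k => // k _ As; rewrite /trexp [in X in _ ^+ X]expnS mul2n.
by apply: mxtrace_expr_even_ge0; rewrite linearD /= linearZ /= As trmx1.
Qed.

Lemma decay_ge0 : 0 <= decay.
Proof. exact: expR_ge0. Qed.

Lemma decay_le1 : decay <= 1.
Proof.
have Lc : 0 <= L * c by rewrite mulr_ge0 ?ltW.
rewrite -[leRHS]expR0 ler_expR oppr_le0 divr_ge0// subr_ge0.
by rewrite -[leRHS]expR0 ler_expR oppr_le0 mulr_ge0 // ltW.
Qed.

(** Golden-Thompson splits off the new draw; then [rank_one_step] and the mean
    1 / c of the draws turn the correction into a multiple of tr W, where W is
    the power that defines the trace before the draw. W is a square, which
    makes the traces tr (W xx^T) nonnegative. *)
Lemma trexp_draw k A (a : R) : (0 < k)%N -> theta * L <= (2 ^ k)%:R ->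
  A^T = A -> 0 <= a -> rowsum_le A a ->
  \sum_i p i * trexp k (A - theta *: outer (x i)) <=
  decay * trexp k A + slack a / (2 ^ k)%:R.
Proof.
move=> k0 kL As a0 Aa; have [p0 p1] := p_distr.
have Hs : (1 + (2 ^ k)%:R^-1 *: A)^T = 1 + (2 ^ k)%:R^-1 *: A.
  by rewrite linearD /= linearZ /= As trmx1.
set W := (1 + (2 ^ k)%:R^-1 *: A) ^+ (2 ^ k).
have W_ge0 i : 0 <= \tr (W * outer (x i)).
  rewrite /W -(prednK k0) [in X in _ ^+ X]expnS mulnC exprM.
  by apply: mxtrace_sqr_outer_ge0; rewrite trmxX (prednK k0) Hs.
set s := (1 - expR (- (theta * L))) / L.
have step i : trexp k (A - theta *: outer (x i)) <=
    \tr W - s * \tr (W * outer (x i)) + slack a / (2 ^ k)%:R.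
  have Bs : (- theta *: outer (x i))^T = - theta *: outer (x i).
    by rewrite linearZ /= outer_sym.
  rewrite /trexp -scaleNr.
  apply: le_trans (mxtrace_exprD_le k a0 b_ge0 As Bs Aa (xb i)) _.
  rewrite lerD2r -/W scalerA mulrN scaleNr.
  by apply: rank_one_step; rewrite // expn_gt0.
apply: (@le_trans _ _
  (\sum_i p i * (\tr W - s * \tr (W * outer (x i)) + slack a / (2 ^ k)%:R))).
  by apply: ler_sum => i _; apply: ler_wpM2l.
under eq_bigr do rewrite mulrDr mulrBr.
rewrite big_split /= sumrB -!mulr_suml p1 !mul1r lerD2r.
have -> : \sum_i p i * (s * \tr (W * outer (x i))) = s * (c^-1 * \tr W).
  transitivity (s * \tr (W * \sum_i p i *: outer (x i))).
    rewrite [W * _]mulr_sumr raddf_sum mulr_sumr /=; apply: eq_bigr => i _.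
    by rewrite -mulmxE -scalemxAr linearZ /=; ring.
  by rewrite x_mean -mulmxE mul_mx_scalar linearZ.
have W0 : 0 <= \tr W by exact: trexp_ge0.
have -> : \tr W - s * (c^-1 * \tr W) = (1 - s / c) * \tr W by ring.
apply: ler_wpM2r => //.
rewrite /decay invfM mulrA -/s; exact: expR_ge1Dx.
Qed.

Definition draws_sum c' (s : {ffun 'I_c' -> 'I_n}) : 'M[R]_m :=
  \sum_j outer (x (s j)).

(** Induction on the number of draws, the first draw being absorbed into A. As
    A moves by at most b in each draw, the errors are all bounded by the slack
    at a + c' b. *)
Lemma trexp_draws k c' A (a : R) : (0 < k)%N -> theta * L <= (2 ^ k)%:R ->
  A^T = A -> 0 <= a -> rowsum_le A a ->
  \sum_(s : {ffun 'I_c' -> 'I_n})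
     (\prod_j p (s j)) * trexp k (A - theta *: draws_sum s) <=
  decay ^+ c' * trexp k A + c'%:R * slack (a + c'%:R * b) / (2 ^ k)%:R.
Proof.
move=> k0 kL; have [p0 p1] := p_distr.
elim: c' A a => [|c' IH] A a As a0 Aa.
  rewrite expr0 mul1r !mul0r addr0.
  rewrite (eq_bigr (fun=> trexp k A)); last first.
    by move=> s _; rewrite /draws_sum !big_ord0 mul1r scaler0 subr0.
  by rewrite sumr_const card_ffun !card_ord expn0.
rewrite big_ffun_cons.
set err := slack (a + c'.+1%:R * b).
have a'E : a + b + c'%:R * b = a + c'.+1%:R * b by rewrite -natr1; ring.
apply: (@le_trans _ _ (\sum_i p i *
  (decay ^+ c' * trexp k (A - theta *: outer (x i))
   + c'%:R * err / (2 ^ k)%:R))).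
  apply: ler_sum => i _.
  have As' : (A - theta *: outer (x i))^T = A - theta *: outer (x i).
    by rewrite linearB /= linearZ /= As outer_sym.
  have Aa' : rowsum_le (A - theta *: outer (x i)) (a + b).
    by rewrite -scaleNr; apply: rowsum_leD.
  have := IH _ _ As' (addr_ge0 a0 b_ge0) Aa'.
  rewrite a'E -/err => /(ler_wpM2l (p0 i)); apply: le_trans.
  rewrite mulr_sumr; apply: ler_sum => s _.
  have -> : \prod_j p (ffun_cons i s j) = p i * \prod_j p (s j).
    rewrite big_ord_recl ffun_cons0; congr (_ * _).
    by apply: eq_bigr => j _; rewrite ffun_consS.
  have -> : draws_sum (ffun_cons i s) = outer (x i) + draws_sum s.
    rewrite /draws_sum big_ord_recl ffun_cons0; congr (_ + _).
    by apply: eq_bigr => j _; rewrite ffun_consS.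
  by rewrite scalerDr opprD addrA mulrA.
under eq_bigr do rewrite mulrDr mulrCA.
rewrite big_split /= -mulr_sumr -mulr_suml p1 mul1r.
have := trexp_draw k0 kL As a0 Aa.
have d0 : 0 <= decay ^+ c' by rewrite exprn_ge0// decay_ge0.
have d1 : decay ^+ c' <= 1 by rewrite exprn_ile1 ?decay_ge0 ?decay_le1.
move/(ler_wpM2l d0); rewrite mulrDr mulrA -exprSr => h.
have ea : slack a <= err by apply: slack_mono => //; rewrite lerDl mulr_ge0.
have u0 : 0 <= (2 ^ k)%:R^-1 :> R by rewrite invr_ge0.
have : decay ^+ c' * (slack a / (2 ^ k)%:R) <= err / (2 ^ k)%:R.
  apply: (@le_trans _ _ (1 * (slack a / (2 ^ k)%:R))).
    by apply: ler_wpM2r d1; rewrite mulr_ge0// slack_ge0.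
  by rewrite mul1r ler_wpM2r.
rewrite -natr1; lra.
Qed.

Lemma trexp_scalar_le k (y : R) : 0 <= y -> trexp k y%:M <= m%:R * expR y.
Proof.
move=> y0; rewrite /trexp.
have -> : (1 : 'M[R]_m) + (2 ^ k)%:R^-1 *: y%:M = (1 + y / (2 ^ k)%:R)%:M.
  by rewrite scale_scalar_mx mulrC [RHS]raddfD.
have powE (z : R) N : (z%:M : 'M[R]_m) ^+ N = (z ^+ N)%:M.
  by elim: N => [|N IH]; rewrite ?expr0// !exprS IH scalar_mxM.
rewrite powE mxtrace_scalar -[leLHS]mulr_natl ler_wpM2l//.
by apply: expr_1Ddivn_le; rewrite ?expn_gt0// addr_ge0// divr_ge0.
Qed.

End Draws.

(** * Hoeffding's comparison for sampling without replacement *)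

Section HoeffdingComparison.
Variables (R : realFieldType) (n c : nat) (V : lmodType R).
Variables (v : 'I_n -> V) (D : V -> Prop) (phi : V -> R).
Implicit Types (s t : {ffun 'I_c -> 'I_n}) (sg : {perm 'I_n}).

Definition total s : V := \sum_j v (s j).
Definition relabel sg s : {ffun 'I_c -> 'I_n} := [ffun j => sg (s j)].
(** Summing over all relabelings of the population leaves a quantity that only
    depends on the pattern of repetitions in s. *)
Definition orbit_sum s : R := \sum_(sg : {perm 'I_n}) phi (total (relabel sg s)).

(* The class D carries the convexity of phi: the traces of powers to which the
   comparison is applied are convex on symmetric matrices. *)
Hypothesis total_D : forall s, D (total s).
Hypothesis phi_convex : forall X Y (l : R), D X -> D Y -> 0 <= l <= 1 ->
  phi (l *: X + (1 - l) *: Y) <= l * phi X + (1 - l) * phi Y.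

Lemma relabelM sg tau s : relabel tau (relabel sg s) = relabel (sg * tau)%g s.
Proof. by apply/ffunP => j; rewrite !ffunE permM. Qed.

Lemma orbit_sum_relabel sg s : orbit_sum (relabel sg s) = orbit_sum s.
Proof.
rewrite /orbit_sum [RHS](reindex_inj (mulgI sg)) /=.
by apply: eq_bigr => tau _; rewrite relabelM.
Qed.

Definition redirect s j1 b : {ffun 'I_c -> 'I_n} :=
  [ffun j => if j == j1 then b else s j].

(** Let the value a be drawn k times in s. Then the total of the redirected
    sequence is the average, with weights 1 - 1/k and 1/k, of the total of s and
    of the total of s with the labels a and b exchanged. Convexity gives the
    inequality, since relabeling does not change the orbit sum. *)
Lemma orbit_sum_redirect s j1 j2 b : j1 != j2 -> s j1 = s j2 ->
  (forall j, s j != b) -> orbit_sum (redirect s j1 b) <= orbit_sum s.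
Proof.
move=> j12 sj12 bs; set a := s j1.
pose k := #|[pred j | s j == a]|.
have k_gt0 : (0 < k)%N by apply/card_gt0P; exists j1; rewrite inE.
pose l : R := 1 - k%:R^-1.
have kR0 : 0 < k%:R :> R by rewrite ltr0n.
have l01 : 0 <= l <= 1.
  rewrite /l subr_ge0 invf_le1// ler1n k_gt0 gerBl invr_ge0 ltW//.
have lE : 1 - l = k%:R^-1 by rewrite /l opprB addrC subrK.
have ab : a != b := bs j1.
have averageE (u : 'I_n -> V) :
    \sum_j u (redirect s j1 b j) =
    l *: (\sum_j u (s j)) + (1 - l) *: (\sum_j u (tperm a b (s j))).
  have -> : \sum_j u (tperm a b (s j)) = \sum_j u (s j) + k%:R *: (u b - u a).
    rewrite scaler_nat -sumr_const [X in _ + X]big_mkcond -big_split /=.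
    apply: eq_bigr => j _; rewrite inE; case: (eqVneq (s j) a) => [->|sja].
      by rewrite tpermL addrC subrK.
    by rewrite tpermD ?addr0// eq_sym// bs.
  rewrite lE scalerDr scalerA mulVf ?gt_eqF// scale1r addrA -scalerDl.
  rewrite /l subrK scale1r (bigD1 j1) //= ffunE eqxx.
  rewrite [in RHS](bigD1 j1) //= -/a [RHS]addrC addrA subrK; congr (_ + _).
  by apply: eq_bigr => j /negbTE jj; rewrite ffunE jj.
apply: (@le_trans _ _ (\sum_(sg : {perm 'I_n})
   (l * phi (total (relabel sg s)) +
    (1 - l) * phi (total (relabel sg (relabel (tperm a b) s)))))).
  apply: ler_sum => sg _.
  have -> : total (relabel sg (redirect s j1 b)) =
      l *: total (relabel sg s)
      + (1 - l) *: total (relabel sg (relabel (tperm a b) s)).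
    have := averageE (fun i => v (sg i)).
    rewrite /total.
    under [in X in _ -> X]eq_bigr do rewrite ffunE.
    move=> ->; congr (_ *: _ + _ *: _); apply: eq_bigr => j _; rewrite !ffunE//.
  exact: phi_convex.
rewrite big_split /= -!mulr_sumr -/(orbit_sum _) -/(orbit_sum _).
by rewrite orbit_sum_relabel -mulrDl addrCA subrr addr0 mul1r.
Qed.

(** A sequence with a repetition misses some label b, because c <= n; redirecting
    a repeated draw to b enlarges the set of drawn labels. The induction is on
    the number of draws by which this set falls short of c. *)
Lemma orbit_sum_injective_le s : (c <= n)%N ->
  exists2 t : {ffun 'I_c -> 'I_n}, injectiveb t & orbit_sum t <= orbit_sum s.
Proof.
move=> cn; move: {2}(c - _)%N (leqnn (c - #|codom s|)) => d.
elim: d s => [|d IH] s.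
  rewrite leqn0 subn_eq0 => h; exists s => //.
  have /image_injP inj : #|codom s| == #|'I_c|.
    by rewrite eqn_leq leq_image_card card_ord.
  by apply/injectiveP => i j; apply: inj.
move=> hd; have [sinj|] := boolP (injectiveb s); first by exists s.
case/injectivePn => j1 [j2 j12 sj12].
have lt_im : (#|codom s| < c)%N.
  have := leq_image_card s 'I_c; rewrite card_ord leq_eqVlt => /predU1P[e|//].
  have /image_injP inj : #|codom s| == #|'I_c| by rewrite e card_ord.
  by move/eqP: j12; case; apply: inj.
have [b bs] : exists b, b \notin codom s.
  apply/existsP; rewrite -negb_forall; apply/negP => /forallP h.
  have : (#|'I_n| <= #|codom s|)%N by apply/subset_leq_card/fintype.subsetP => i _.
  by rewrite card_ord leqNgt (leq_trans lt_im cn).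
have bs' j : s j != b by apply: contraNneq bs => <-; apply: codom_f.
have [t tinj tle] : exists2 t : {ffun 'I_c -> 'I_n},
    injectiveb t & orbit_sum t <= orbit_sum (redirect s j1 b).
  apply: IH.
  have : (#|codom s| < #|codom (redirect s j1 b)|)%N.
    have := cardU1 b (mem (codom s)); rewrite bs add1n => <-.
    apply/subset_leq_card/fintype.subsetP => i /predU1P[->|].
      by apply/codomP; exists j1; rewrite // ffunE eqxx.
    case/codomP => j ->; apply/codomP; have [jj|jj] := eqVneq j j1.
      by exists j2; rewrite // ffunE eq_sym (negbTE j12) jj.
    by exists j; rewrite // ffunE (negbTE jj).
  by move: hd lt_im; lia.
exists t => //; apply: le_trans tle _; exact: orbit_sum_redirect j12 sj12 bs'.
Qed.

(** A transposition makes s agree with t at one more place, and injectivity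
    prevents it from disturbing the places where they already agree. *)
Lemma relabel_injective s t : injectiveb s -> injectiveb t ->
  exists sg, relabel sg s = t.
Proof.
move=> /injectiveP sinj /injectiveP tinj.
move: {2}#|[pred j | s j != t j]| (leqnn #|[pred j | s j != t j]|) => d.
elim: d s sinj => [|d IH] s sinj hd.
  exists 1%g; apply/ffunP => j; rewrite ffunE perm1.
  move: hd; rewrite leqn0 => /eqP/card0_eq/(_ j); rewrite inE.
  by move/negbFE/eqP.
have [j sj|st] := pickP (fun j => s j != t j); last first.
  by exists 1%g; apply/ffunP => j; rewrite ffunE perm1; apply/eqP/negbFE/st.
have [||sg <-] := IH (relabel (tperm (s j) (t j)) s).
- by move=> i i'; rewrite !ffunE => /perm_inj/sinj.
- rewrite -ltnS; apply: leq_trans hd; apply: proper_card; apply/properP; split.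
    apply/fintype.subsetP => i; rewrite !inE ffunE.
    case: (eqVneq (s i) (t i)) => // sti.
    rewrite tpermD ?sti ?eqxx//.
      rewrite -sti; apply: contraNneq sj => /sinj ->; by rewrite sti.
    by apply: contraNneq sj => /tinj ->; rewrite sti.
  by exists j; rewrite !inE// ffunE tpermL eqxx.
by exists (tperm (s j) (t j) * sg)%g; rewrite -relabelM.
Qed.

Lemma relabel_inj sg : injective (relabel sg).
Proof.
move=> s t /ffunP h; apply/ffunP => j; have := h j.
by rewrite !ffunE => /perm_inj.
Qed.

Lemma injectiveb_relabel sg s : injectiveb (relabel sg s) = injectiveb s.
Proof.
apply/injectiveP/injectiveP => h i j; last by rewrite !ffunE => /perm_inj/h.
by move=> sij; apply: h; rewrite !ffunE sij.
Qed.

Lemma sum_orbit_sum (P : pred {ffun 'I_c -> 'I_n}) :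
  (forall sg s, P (relabel sg s) = P s) ->
  \sum_(s | P s) orbit_sum s = #|{perm 'I_n}|%:R * \sum_(s | P s) phi (total s).
Proof.
move=> Pinv; rewrite exchange_big /= mulr_natl -sumr_const.
apply: eq_bigr => sg _; rewrite [RHS](reindex_inj (@relabel_inj sg)) /=.
by apply: eq_bigl => s; rewrite Pinv.
Qed.

(** The orbit sum is constant on injective sequences, and no larger there than
    anywhere else. Summed over all sequences of either kind, the orbit sums are
    n! times the sums of the values of phi. *)
Lemma hoeffding_comparison : (c <= n)%N ->
  (n ^_ c)%:R^-1 * \sum_(s : {ffun 'I_c -> 'I_n} | injectiveb s) phi (total s) <=
  (n ^ c)%:R^-1 * \sum_s phi (total s).
Proof.
move=> cn; have ffact0 : (n ^_ c)%:R != 0 :> R.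
  by rewrite pnatr_eq0 -lt0n ffact_gt0.
have exp0 : 0 < (n ^ c)%:R :> R.
  by rewrite ltr0n expn_gt0; case: (c) n cn => [|c'] [].
have perm0 : 0 < #|{perm 'I_n}|%:R :> R.
  by rewrite ltr0n; apply/card_gt0P; exists 1%g.
have [t tinj _] := orbit_sum_injective_le [ffun j => widen_ord cn j] cn.
have orbit_inj s : injectiveb s -> orbit_sum s = orbit_sum t.
  by move=> /relabel_injective/(_ tinj)[sg <-]; rewrite orbit_sum_relabel.
have orbit_ge s : orbit_sum t <= orbit_sum s.
  by have [u /orbit_inj <-] := orbit_sum_injective_le s cn.
have := sum_orbit_sum injectiveb_relabel.
rewrite (eq_bigr (fun=> orbit_sum t)); last by move=> s; apply: orbit_inj.
have -> : \sum_(s : {ffun 'I_c -> 'I_n} | injectiveb s) orbit_sum t =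
    (n ^_ c)%:R * orbit_sum t.
  have := card_inj_ffuns 'I_c 'I_n; rewrite !card_ord => <-.
  rewrite mulr_natl -sumr_const; apply: eq_bigl => s; by rewrite inE.
move=> injE.
have := sum_orbit_sum (P := xpredT) (fun _ _ => erefl) => allE.
have : (n ^ c)%:R * orbit_sum t <= #|{perm 'I_n}|%:R * \sum_s phi (total s).
  rewrite -allE mulr_natl -[X in _ *+ (_ ^ X)](card_ord c).
  rewrite -[X in _ *+ (X ^ _)](card_ord n) -card_ffun -sumr_const.
  exact: ler_sum.
move=> h; rewrite -(ler_pM2l perm0) mulrCA -injE mulKf//.
by rewrite mulrCA mulrC ler_pdivlMr// mulrC.
Qed.
End HoeffdingComparison.

(** * The lower tail of a sum of draws *)

Section Spectral.
Variables (R : realType) (m : nat).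
Implicit Types (A H : 'M[R]_m) (v : 'rV[R]_m).

(** Subtracting from H its part along the eigenvector leaves a symmetric matrix
    whose square has trace tr H^2 - f^2. *)
Lemma sqr_eigenvalue_le_mxtrace H v f : H^T = H -> v != 0 -> v *m H = f *: v ->
  f ^+ 2 <= \tr (H ^+ 2).
Proof.
move=> Hs v0 vH.
have vs : sqnorm v^T != 0.
  by apply: contra_neq v0 => /sqnorm_eq0/(congr1 trmx); rewrite trmxK trmx0.
set P := outer v^T; pose t := f / sqnorm v^T.
have := mxtrace_sqr_ge0 (A := H - t *: P).
rewrite linearB /= linearZ /= outer_sym Hs => /(_ erefl).
have PH : P * H = f *: P by rewrite /P /outer trmxK -mulmxE -mulmxA vH -scalemxAr.
have HP : H * P = f *: P.
  by rewrite -[LHS]trmxK trmxM outer_sym Hs PH linearZ /= outer_sym.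
have trP : \tr P = sqnorm v^T by [].
rewrite expr2 mulrBl !mulrBr -!mulmxE -!scalemxAl -!scalemxAr !mulmxE.
rewrite PH HP outer_sqr !scalerA !linearB /= !linearZ /= trP -expr2.
have e1 : (t * f) *: - sqnorm v^T = - f ^+ 2 :> R.
  by rewrite -[LHS]/(t * f * - sqnorm v^T) /t; field.
have e2 : (t * t * sqnorm v^T) *: - - sqnorm v^T = f ^+ 2 :> R.
  by rewrite opprK -[LHS]/(t * t * sqnorm v^T * sqnorm v^T) /t; field.
rewrite e1 e2; lra.
Qed.

(** The N-th power of 1 + A / N is a square with the eigenvalue (1 + f / N)^N,
    which is at least 1. *)
Lemma trexp_ge1 k A v f : (0 < k)%N -> A^T = A -> v != 0 -> v *m A = f *: v ->
  0 <= f -> 1 <= trexp k A.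
Proof.
case: k => // k _ As v0 vA f0; rewrite /trexp; set u := _^-1.
have u0 : 0 <= u by rewrite invr_ge0.
have vX N : v *m (1 + u *: A) ^+ N = (1 + u * f) ^+ N *: v.
  elim: N => [|N IH]; first by rewrite !expr0 mulmx1 scale1r.
  rewrite exprSr -mulmxE mulmxA IH -scalemxAl mulmxDr mulmx1 -scalemxAr vA.
  by rewrite exprSr -[RHS]scalerA scalerDl scale1r scalerA.
rewrite [in X in _ ^+ X]expnS mulnC exprM.
apply: le_trans (sqr_eigenvalue_le_mxtrace _ v0 (vX _)); last first.
  by rewrite trmxX linearD /= linearZ /= As trmx1.
by rewrite -exprM exprn_ege1// lerDl mulr_ge0.
Qed.

Lemma trexp_convex k A B l : (0 < k)%N -> A^T = A -> B^T = B -> 0 <= l <= 1 ->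
  trexp k (l *: A + (1 - l) *: B) <= l * trexp k A + (1 - l) * trexp k B.
Proof.
move=> k0 As Bs l01; rewrite /trexp; set u := _^-1.
have -> : 1 + u *: (l *: A + (1 - l) *: B) =
    l *: (1 + u *: A) + (1 - l) *: (1 + u *: B).
  rewrite !scalerDr !scalerA ![_ * u]mulrC addrACA -[in RHS]scalerDl.
  by rewrite [l + _]addrC subrK scale1r.
by apply: mxtrace_expr_convex => //; rewrite linearD /= linearZ /= ?As ?Bs trmx1.
Qed.
End Spectral.

Lemma le_of_dyadic_error (R : realType) (X B C T : R) :
  (forall k, (0 < k)%N -> T <= (2 ^ k)%:R -> X <= B + C / (2 ^ k)%:R) -> X <= B.
Proof.
move=> h; apply/ler_addgt0Pr => e e0.
pose z := `|T| + `|C| / e + 1.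
have z0 : 0 <= z by rewrite /z !addr_ge0// divr_ge0// ltW.
have [k zk] : exists k, z <= (2 ^ k.+1)%:R.
  have := archi_boundP z0; set k := Num.bound z => /ltW zk; exists k.
  by apply: le_trans zk _; rewrite ler_nat ltnW// ltnW// ltn_expl.
have Ce0 : 0 <= `|C| / e by rewrite divr_ge0// ltW.
apply: le_trans (h k.+1 isT _) _.
  by apply: le_trans zk; apply: le_trans (ler_norm T) _; rewrite /z; lra.
rewrite lerD2l ler_pdivrMr ?ltr0n ?expn_gt0//.
apply: le_trans (ler_norm C) _; rewrite mulrC -ler_pdivrMr//.
by apply: le_trans zk; have := normr_ge0 T; rewrite /z; lra.
Qed.

(** The large deviation rate of the lower tail; [c1] is eps^2 divided by it. *)
Definition lower_rate (R : realType) (eps : R) : R := (1 - eps) * ln (1 - eps) + eps.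

Section Tail.
Variables (R : realType) (m n c : nat) (x : 'I_n -> 'cV[R]_m) (p : 'I_n -> R).
Variables (L eps : R).
Hypotheses (p_distr : is_distribution p) (L_gt0 : 0 < L) (c_gt0 : (0 < c)%N).
Hypotheses (eps01 : 0 < eps < 1) (x_le : forall i, sqnorm (x i) <= L).
Hypothesis x_mean : \sum_i p i *: outer (x i) = (c%:R^-1)%:M.
Local Notation draws := {ffun 'I_c -> 'I_n}.

(* This choice of theta minimizes the final bound: exp (- theta L) = 1 - eps. *)
Let theta : R := - ln (1 - eps) / L.
Let theta_ge0 : 0 <= theta.
Proof.
have /andP[e0 e1] := eps01.
by rewrite divr_ge0// ?(ltW L_gt0)// oppr_ge0 ln_le0//; lra.
Qed.

(** The Laplace transform of the draws, normalized so that it is at least 1 as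
    soon as the sum of the draws has an eigenvalue at most 1 - eps. *)
Definition potential k (s : draws) : R :=
  trexp k ((theta * (1 - eps))%:M - theta *: draws_sum x s).

Lemma draws_sum_sym (s : draws) : (draws_sum x s)^T = draws_sum x s.
Proof. by rewrite /draws_sum linear_sum; apply: eq_bigr => j _; exact: outer_sym. Qed.

Let shift_sym (S : 'M[R]_m) : S^T = S ->
  ((theta * (1 - eps))%:M - theta *: S)^T = (theta * (1 - eps))%:M - theta *: S.
Proof. by move=> Ss; rewrite linearB /= tr_scalar_mx linearZ /= Ss. Qed.

Lemma potential_ge0 k s : (0 < k)%N -> 0 <= potential k s.
Proof. by move=> k0; apply: trexp_ge0 => //; exact/shift_sym/draws_sum_sym. Qed.

Lemma potential_ge1 k s a : (0 < k)%N -> eigenvalue (draws_sum x s) a ->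
  a <= 1 - eps -> 1 <= potential k s.
Proof.
move=> k0 /eigenvalueP[v vS v0] ae.
apply: (@trexp_ge1 _ _ k _ v (theta * (1 - eps - a))) => //.
- exact/shift_sym/draws_sum_sym.
- rewrite mulmxBr mul_mx_scalar -scalemxAr vS scalerA -scalerBl.
  by rewrite -mulrBr.
- by rewrite mulr_ge0// subr_ge0.
Qed.

(** After all c draws the mean trace has shrunk by exp (- (1 - exp (- theta L)) / L)
    from the initial value m exp (theta (1 - eps)); the choice of theta turns the
    product into the rate function. *)
Lemma potential_mean : exists C, forall k, (0 < k)%N -> theta * L <= (2 ^ k)%:R ->
  \sum_(s : draws) (\prod_j p (s j)) * potential k s <=
  m%:R * expR (- (lower_rate eps / L)) + C / (2 ^ k)%:R.
Proof.
have /andP[e0 e1] := eps01; pose y := theta * (1 - eps).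
have y0 : 0 <= y by rewrite mulr_ge0//; lra.
have [b b0 xb] := rowsum_le_family (fun i => - theta *: outer (x i)).
have [a a0 /(_ tt) ya] := rowsum_le_family (fun _ : unit => y%:M : 'M[R]_m).
exists (c%:R * slack m b (a + c%:R * b)) => k k0 kL.
have ys : (y%:M : 'M[R]_m)^T = y%:M by rewrite tr_scalar_mx.
have cR0 : 0 < c%:R :> R by rewrite ltr0n.
apply: le_trans (trexp_draws p_distr theta_ge0 L_gt0 cR0 x_le x_mean
                   b0 xb c k0 kL ys a0 ya) _.
rewrite lerD2r.
have : decay theta L c%:R ^+ c * trexp k (y%:M : 'M[R]_m) <=
       decay theta L c%:R ^+ c * (m%:R * expR y).
  by rewrite ler_wpM2l ?trexp_scalar_le// exprn_ge0// expR_ge0.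
move/le_trans; apply; rewrite mulrCA ler_wpM2l//.
have thL : theta * L = - ln (1 - eps) by rewrite /theta divfK ?gt_eqF.
rewrite /decay -expRM_natl -expRD ler_expR thL opprK lnK; last by rewrite posrE; lra.
rewrite le_eqVlt; apply/orP; left; apply/eqP.
by rewrite /y /theta /lower_rate; field; rewrite !gt_eqF.
Qed.

(** Markov's inequality for the potential, for any law q under which the
    potential has no larger mean than for independent draws. The bound of the
    mean holds up to C / 2^k for every large k, while the left-hand side does not
    depend on k. *)
Lemma chernoff_lower_tail (q : draws -> R) (bad : pred draws) :
  (forall s, 0 <= q s) ->
  (forall k, (0 < k)%N -> \sum_(s : draws) q s * potential k s <=
                          \sum_(s : draws) (\prod_j p (s j)) * potential k s) ->
  (forall s, bad s -> exists2 a, eigenvalue (draws_sum x s) a & a <= 1 - eps) ->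
  \sum_(s | bad s) q s <= m%:R * expR (- (lower_rate eps / L)).
Proof.
move=> q0 qle badP; have [C HC] := potential_mean.
apply: (@le_of_dyadic_error _ _ _ C (theta * L)) => k k0 kL.
apply: le_trans (HC k k0 kL); apply: le_trans (qle k k0).
rewrite big_mkcond; apply: ler_sum => s _; case: ifP => [/badP[a ea ale]|_].
  by rewrite ler_peMr// (potential_ge1 k0 ea ale).
by rewrite mulr_ge0// potential_ge0.
Qed.

End Tail.

(** The potential is a convex function of the sum of the draws, so it falls under
    Hoeffding's comparison. *)
Lemma potential_without_replacement (R : realType) (m n c : nat)
    (x : 'I_n -> 'cV[R]_m) (L eps : R) k : (0 < k)%N -> (c <= n)%N ->
  \sum_(s : {ffun 'I_c -> 'I_n})
     (if injectiveb s then (n ^_ c)%:R^-1 else 0) * potential x L eps k s <=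
  \sum_(s : {ffun 'I_c -> 'I_n})
     (\prod_(j < c) uniform_distribution R (s j)) * potential x L eps k s.
Proof.
move=> k0 cn.
under eq_bigr do rewrite (fun_if (fun z => z * _)) mul0r.
rewrite -big_mkcond /= -mulr_sumr.
under [leRHS]eq_bigr do rewrite prodr_const card_ord exprVn -natrX.
rewrite -mulr_sumr.
apply: (@hoeffding_comparison _ n c _ (fun i => outer (x i)) (fun S => S^T = S)
  (fun S => trexp k ((- ln (1 - eps) / L * (1 - eps))%:M
                     - (- ln (1 - eps) / L) *: S))) => //.
  by move=> s; apply: (draws_sum_sym x).
move=> X Y l Xs Ys l01; set th := - ln (1 - eps) / L; set y := th * _.
have -> : y%:M - th *: (l *: X + (1 - l) *: Y) =
   l *: (y%:M - th *: X) + (1 - l) *: (y%:M - th *: Y).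
  rewrite !scalerBr !scalerA scalerDr !scalerA ![_ * th]mulrC addrACA -scalerDl.
  by rewrite [l + _]addrC subrK scale1r opprD.
by apply: trexp_convex => //; rewrite linearB /= tr_scalar_mx linearZ /= ?Xs ?Ys.
Qed.

(** * The rate, the sketch and the law of the sample *)

(** Put G (u) = u ln u + 1 - u - (1 - u)^2 / 2. Then G (1) = 0 and
    G' (u) = ln u + 1 - u <= 0, so G (1 - eps) is nonnegative. *)
Lemma lower_rate_ge (R : realType) (eps : R) : 0 < eps < 1 ->
  eps ^+ 2 / 2 <= lower_rate eps.
Proof.
move=> /andP[e0 e1].
pose G (u : R) := u * ln u + 1 - u - (1 - u) ^+ 2 / 2.
have dG (u : R) : 0 < u -> is_derive u 1 G (ln u + 1 - u).
  move=> u0; have := is_derive1_ln u0 => dln.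
  rewrite /G; apply: is_derive_eq.
  rewrite /GRing.scale /= ; field; rewrite gt_eqF//.
have cG : {within `[1 - eps, 1], continuous G}.
  apply: derivable_within_continuous => u; rewrite in_itv /= => /andP[u0 _].
  by apply: ex_derive; apply: dG; lra.
have [|u|v] := @MVT_segment R G (fun u => ln u + 1 - u) (1 - eps) 1 _ _ cG.
- lra.
- by rewrite in_itv /= => /andP[u0 _]; apply: dG; lra.
rewrite in_itv /= => /andP[v0 v1].
have lnv : ln v <= v - 1.
  by have := @le_ln1Dx R (v - 1); rewrite [1 + _]addrC subrK; apply; lra.
have : (ln v + 1 - v) * (1 - (1 - eps)) <= 0.
  by rewrite mulr_le0_ge0//; lra.
rewrite /G /lower_rate ln1; lra.
Qed.

Lemma lower_rate_le (R : realType) (eps : R) : 0 < eps < 1 ->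
  lower_rate eps <= eps ^+ 2.
Proof.
move=> /andP[e0 e1]; have := @le_ln1Dx R (- eps); rewrite /lower_rate => h.
have e1' : 0 <= 1 - eps by lra.
have : ln (1 - eps) <= - eps by apply: h; lra.
move=> /(ler_wpM2l e1'); lra.
Qed.

Lemma c1E (R : realType) (eps : R) : c1 eps = eps ^+ 2 / lower_rate eps.
Proof. by []. Qed.

Lemma c1_bounds (R : realType) (eps : R) : 0 < eps < 1 -> 1 <= c1 eps <= 2.
Proof.
move=> eps01; have /andP[e0 _] := eps01.
have h1 := lower_rate_ge eps01; have h2 := lower_rate_le eps01.
have e2 : 0 < eps ^+ 2 by rewrite exprn_gt0.
have h0 : 0 < lower_rate eps by lra.
by rewrite c1E ler_pdivlMr// ler_pdivrMr// mul1r h2 /=; lra.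
Qed.

(** With L = K / c, the condition on c says that lower_rate eps / L is at least
    ln (m / delta). *)
Lemma failure_le_delta (R : realType) (m c : nat) (eps delta K : R) :
  (0 < m)%N -> (0 < c)%N -> 0 < eps < 1 -> 0 < delta -> 0 < K ->
  c1 eps * K * (ln (m%:R / delta) / eps ^+ 2) <= c%:R ->
  m%:R * expR (- (lower_rate eps / (K / c%:R))) <= delta.
Proof.
move=> m0 c0 eps01 d0 K0; have /andP[e0 _] := eps01.
have h1 := lower_rate_ge eps01.
have e2 : 0 < eps ^+ 2 by rewrite exprn_gt0.
have h0 : 0 < lower_rate eps by lra.
have mR : 0 < m%:R :> R by rewrite ltr0n.
have cR : 0 < c%:R :> R by rewrite ltr0n.
set h := lower_rate eps in h1 h0 *; set l := ln _; rewrite c1E -/h.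
have -> : eps ^+ 2 / h * K * (l / eps ^+ 2) = K * l / h.
  by field; rewrite !gt_eqF.
rewrite ler_pdivrMr// => hc.
have : l <= h / (K / c%:R).
  have -> : h / (K / c%:R) = c%:R * h / K by field; rewrite !gt_eqF.
  by rewrite ler_pdivlMr// mulrC.
move=> hl; have : expR (- (h / (K / c%:R))) <= expR (- l) by rewrite ler_expR lerN2.
rewrite [X in _ <= X]expRN /l lnK ?posrE ?divr_gt0//.
move=> /(ler_wpM2l (ltW mR)) /le_trans; apply.
by rewrite invf_div [leLHS]mulrC divfK// gt_eqF.
Qed.

Section Sketch.
Variables (R : realType) (m n : nat) (Q : 'M[R]_(m, n)) (p : 'I_n -> R) (c : nat).
Hypothesis p_ge0 : forall i, 0 <= p i.

(** The possible columns of the sketch QS: drawing the index i appends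
    [scaled_col i]. *)
Definition scaled_col i : 'cV[R]_m := (Num.sqrt (c%:R * p i))^-1 *: col i Q.

Lemma sketch_gram (t : 'I_c -> 'I_n) (s : {ffun 'I_c -> 'I_n}) :
  (forall j, s j = t j) ->
  (Q *m sampling_matrix p t) *m (Q *m sampling_matrix p t)^T =
  draws_sum scaled_col s.
Proof.
move=> st.
have QS i j : (Q *m sampling_matrix p t) i j = scaled_col (s j) i 0.
  rewrite !mxE st (bigD1 (t j)) //= !mxE eqxx big1 ?addr0 => [|k kt].
    by rewrite mul1r mulrC.
  by rewrite !mxE (negbTE kt) mul0r mulr0.
apply/matrixP => i k; rewrite mxE /draws_sum summxE; apply: eq_bigr => j _.
by rewrite [X in _ * X]mxE !QS [in RHS]mxE big_ord1 [X in _ = _ * X]mxE.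
Qed.

Lemma two_norm_sqr (x : 'cV[R]_m) : two_norm x ^+ 2 = sqnorm x.
Proof. by rewrite sqnormE sqr_sqrtr// sumr_ge0// => i _; rewrite sqr_ge0. Qed.

Lemma outerZ (a : R) (x : 'cV[R]_m) : outer (a *: x) = a ^+ 2 *: outer x.
Proof. by rewrite /outer linearZ /= -scalemxAr -scalemxAl scalerA expr2. Qed.

Lemma outer_scaled_col i : outer (scaled_col i) = (c%:R * p i)^-1 *: outer (col i Q).
Proof. by rewrite outerZ exprVn sqr_sqrtr// mulr_ge0. Qed.

Lemma sqnorm_scaled_col i : sqnorm (scaled_col i) = sqnorm (col i Q) / (c%:R * p i).
Proof. by rewrite /sqnorm outer_scaled_col linearZ /= mulrC. Qed.

Lemma sum_outer_col : \sum_i outer (col i Q) = Q *m Q^T.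
Proof.
apply/matrixP => i k; rewrite summxE mxE; apply: eq_bigr => j _.
by rewrite mxE big_ord1 !mxE.
Qed.

Lemma scaled_col_mean : (forall i, p i = 0 -> col i Q = 0) -> Q *m Q^T = 1%:M ->
  \sum_i p i *: outer (scaled_col i) = (c%:R^-1)%:M.
Proof.
move=> p0 QQ; transitivity (c%:R^-1 *: \sum_i outer (col i Q)); last first.
  by rewrite sum_outer_col QQ scale_scalar_mx mulr1.
rewrite scaler_sumr; apply: eq_bigr => i _; rewrite outer_scaled_col scalerA.
have [pi0|pi0] := eqVneq (p i) 0.
  by rewrite (p0 i pi0) /outer mul0mx !scaler0.
by rewrite invfM mulrCA mulfV// mulr1.
Qed.

Lemma small_sigma_eigenvalue (eps : R) (t : 'I_c -> 'I_n) (s : {ffun 'I_c -> 'I_n}) :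
  (0 < m)%N -> (forall j, s j = t j) ->
  ~~ (Num.sqrt (1 - eps) <= sigma_m (Q *m sampling_matrix p t)) ->
  exists2 a, eigenvalue (draws_sum scaled_col s) a & a <= 1 - eps.
Proof.
move=> m0 st; rewrite /sigma_m (sketch_gram st) => h.
have [ev _] := smallest_eigenvalueP m0 (draws_sum_sym scaled_col s).
exists (smallest_eigenvalue (draws_sum scaled_col s)) => //.
by rewrite leNgt; apply: contra h => /ltW; exact: ler_wsqrtr.
Qed.
End Sketch.

Section Law.
Variables (d : measure_display) (T : measurableType d) (R : realType).
Variables (P : probability T R) (n c : nat) (t : 'I_c -> T -> 'I_n).
Local Notation draws := {ffun 'I_c -> 'I_n}.

(** Only finitely many sequences can be drawn, so the complement of the event is
    a finite union of events with known probabilities. *)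
Lemma probability_good_ge (q : draws -> R) (good : pred draws) (delta : R) :
  random_indices t ->
  (forall s : draws, P [set w | forall j, t j w = s j] = (q s)%:E) ->
  \sum_(s | ~~ good s) q s <= delta ->
  ((1 - delta)%:E <= P [set w | good [ffun j => t j w]])%E.
Proof.
move=> tm tq qd.
pose A (s : draws) := [set w | forall j, t j w = s j].
have Am s : measurable (A s).
  have -> : A s = \bigcap_(j in [set: 'I_c]) [set w | t j w = s j].
    by apply/seteqP; split=> w /= h j => [_|]; apply: h.
  by apply: fin_bigcap_measurable => // j _; apply: tm.
pose B := \big[setU/set0]_(s | ~~ good s) A s.
have Bm : measurable B by apply: bigsetU_measurable.
have goodE : [set w | good [ffun j => t j w]] = ~` B.
  apply/seteqP; split=> w /=.
    move=> gw; rewrite /B -bigcup_seq_cond => -[s /= /andP[_ bs] sw].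
    move: bs; rewrite (_ : s = [ffun j => t j w]) ?gw//.
    by apply/ffunP => j; rewrite ffunE sw.
  move=> nB; apply/negPn/negP => bw; apply: nB; rewrite /B -bigcup_seq_cond.
  by exists [ffun j => t j w] => [/=|j]; rewrite ?mem_index_enum ?ffunE.
have PB : (P B <= (\sum_(s | ~~ good s) q s)%:E)%E.
  rewrite /B; elim: (index_enum _) => [|s r IH]; first by rewrite !big_nil measure0.
  rewrite !big_cons; case: ifP => // _.
  apply: le_trans (measureU2 P (Am s) _) _; first exact: bigsetU_measurable.
  by rewrite EFinD; apply: leeD; [rewrite -tq | exact: IH].
rewrite goodE probability_setC// EFinB leeB//.
by apply: le_trans PB _; rewrite lee_fin.
Qed.

Lemma law_with_replacement (p : 'I_n -> R) (s : draws) :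
  sampled_with_replacement P p t ->
  P [set w | forall j, t j w = s j] = (\prod_j p (s j))%:E.
Proof.
case=> _ tp ti; have := ti [set: 'I_c]%SET (fun j => [set s j]).
have -> : [set w | forall j, j \in [set: 'I_c]%SET -> [set s j] (t j w)] =
          [set w | forall j, t j w = s j].
  apply/seteqP; split=> w /= h j => [|_]; last exact: h.
  by apply: h; rewrite finset.inE.
move=> ->; rewrite -prodEFin; apply: eq_big => [j|j _]; first by rewrite finset.inE.
exact: tp.
Qed.

Lemma law_without_replacement (s : draws) : sampled_without_replacement P t ->
  P [set w | forall j, t j w = s j] =
  (if injectiveb s then (n ^_ c)%:R^-1 else 0)%:E.
Proof. by case=> _ ->; case: ifP. Qed.
End Law.

(** * Sampling with orthonormal rows *)

Lemma frobenius_norm_sqr (R : realType) (m n : nat) (Q : 'M[R]_(m, n)) :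
  Q *m Q^T = 1%:M -> frobenius_norm Q ^+ 2 = m%:R.
Proof.
move=> QQ; rewrite sqr_sqrtr; last first.
  by apply: sumr_ge0 => i _; apply: sumr_ge0 => j _; rewrite sqr_ge0.
rewrite -(mxtrace1 R m) -QQ; apply: eq_bigr => i _; rewrite mxE.
by apply: eq_bigr => j _; rewrite mxE expr2.
Qed.

Lemma sum_sqnorm_col (R : realType) (m n : nat) (Q : 'M[R]_(m, n)) :
  Q *m Q^T = 1%:M -> \sum_j sqnorm (col j Q) = m%:R.
Proof. by move=> QQ; rewrite -(mxtrace1 R m) -QQ -sum_outer_col raddf_sum. Qed.

Lemma sqnorm_col_le_coherence (R : realType) (m n : nat) (Q : 'M[R]_(m, n)) j :
  sqnorm (col j Q) <= coherence Q.
Proof. by rewrite -two_norm_sqr /coherence; exact: (le_bigmax _ _ j). Qed.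

Lemma coherence_gt0 (R : realType) (m n : nat) (Q : 'M[R]_(m, n)) :
  (0 < m)%N -> Q *m Q^T = 1%:M -> 0 < coherence Q.
Proof.
move=> m0 QQ; rewrite ltNge; apply/negP => mu0.
have : 0 < m%:R :> R by rewrite ltr0n.
rewrite -(sum_sqnorm_col QQ) ltNge; apply/negP/negPn; apply: sumr_le0 => j _.
exact: le_trans (sqnorm_col_le_coherence Q j) mu0.
Qed.

Lemma uniform_is_distribution (R : realType) (n : nat) : (0 < n)%N ->
  is_distribution (@uniform_distribution R n).
Proof.
move=> n0; split=> [i|]; first by rewrite invr_ge0.
by rewrite sumr_const card_ord -[LHS]mulr_natr mulVf// pnatr_eq0 -lt0n.
Qed.

(** All sampling schemes share the bound |Q_i|^2 <= K p_i: K = m / beta for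
    nearly optimal probabilities and K = n mu for uniform ones. It bounds the
    scaled columns by K / c, and implies that indices of probability zero belong
    to zero columns, which do not contribute to the mean of the draws. The law q
    of the sampled sequence is kept general to cover sampling without
    replacement. *)
Lemma sketch_sigma_ge (R : realType) (m n c : nat) (Q : 'M[R]_(m, n))
    (eps delta K : R) (p : 'I_n -> R) (q : {ffun 'I_c -> 'I_n} -> R)
    (d : measure_display) (T : measurableType d) (P : probability T R)
    (t : 'I_c -> T -> 'I_n) :
  (0 < m)%N -> Q *m Q^T = 1%:M -> 0 < eps < 1 -> 0 < delta -> (0 < c)%N ->
  is_distribution p -> 0 < K -> (forall i, sqnorm (col i Q) <= K * p i) ->
  c1 eps * K * (ln (m%:R / delta) / eps ^+ 2) <= c%:R ->
  random_indices t ->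
  (forall s : {ffun 'I_c -> 'I_n}, P [set w | forall j, t j w = s j] = (q s)%:E) ->
  (forall s, 0 <= q s) ->
  (forall k, (0 < k)%N ->
    \sum_(s : {ffun 'I_c -> 'I_n})
      q s * potential (scaled_col Q p c) (K / c%:R) eps k s <=
    \sum_(s : {ffun 'I_c -> 'I_n})
      (\prod_j p (s j)) * potential (scaled_col Q p c) (K / c%:R) eps k s) ->
  ((1 - delta)%:E <= P [set w | (Num.sqrt (1 - eps) <=
     sigma_m (Q *m sampling_matrix p (t ^~ w)))%R])%E.
Proof.
move=> m0 QQ eps01 d0 c0 pd K0 Kp hc tm tq q0 qle; have [p0 _] := pd.
pose good (s : {ffun 'I_c -> 'I_n}) :=
  Num.sqrt (1 - eps) <= sigma_m (Q *m sampling_matrix p s).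
have -> : [set w | Num.sqrt (1 - eps) <= sigma_m (Q *m sampling_matrix p (t ^~ w))] =
          [set w | good [ffun j => t j w]].
  apply: eq_set => w; rewrite /good.
  rewrite (_ : fun_of_fin [ffun j => t j w] = t ^~ w)//.
  by apply/funext => j; rewrite ffunE.
apply: (probability_good_ge tm tq).
have cR : 0 < c%:R :> R by rewrite ltr0n.
apply: le_trans (failure_le_delta m0 c0 eps01 d0 K0 hc).
have L0 : 0 < K / c%:R by rewrite divr_gt0.
apply: (chernoff_lower_tail pd L0 c0 eps01 _ _ q0 qle).
- move=> i; rewrite (sqnorm_scaled_col _ _ p0).
  have [pi0|pi0] := eqVneq (p i) 0; first by rewrite pi0 mulr0 invr0 mulr0 ltW.
  rewrite invfM mulrA mulrAC ler_pM2r ?invr_gt0//.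
  by rewrite ler_pdivrMr// lt_def pi0 p0.
- apply: scaled_col_mean => // i pi0; apply: sqnorm_eq0; apply/eqP.
  by rewrite eq_le sqnorm_ge0 andbT -[0](mulr0 K) -pi0 Kp.
- by move=> s; apply: small_sigma_eigenvalue.
Qed.

Theorem theorem6p2 (R : realType) (m n : nat) (Q : 'M[R]_(m, n))
    (eps delta : R) (m_gt0 : (0 < m)%N) (orthoQ : Q *m Q^T = 1%:M)
    (eps01 : 0 < eps < 1) (delta01 : 0 < delta < 1) :
  [/\ 1 <= c1 eps <= 2,
      forall (d : measure_display) (T : measurableType d) (P : probability T R)
          (c : nat) (beta : R) (p : 'I_n -> R) (t : 'I_c -> T -> 'I_n),
        (1 <= c <= n)%N -> 0 < beta <= 1 -> nearly_optimal Q beta p ->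
        sampled_with_replacement P p t ->
        c1 eps * m%:R * (ln (m%:R / delta) / (beta * eps ^+ 2)) <= c%:R ->
        ((1 - delta)%:E <=
         P [set w | (Num.sqrt (1 - eps) <=
                     sigma_m (Q *m sampling_matrix p (t ^~ w)))%R])%E
    & forall (d : measure_display) (T : measurableType d) (P : probability T R)
          (c : nat) (t : 'I_c -> T -> 'I_n),
        (1 <= c <= n)%N ->
        sampled_with_replacement P (@uniform_distribution R n) t \/
        sampled_without_replacement P t ->
        c1 eps * n%:R * coherence Q * (ln (m%:R / delta) / eps ^+ 2) <= c%:R ->
        ((1 - delta)%:E <=
         P [set w | (Num.sqrt (1 - eps) <=
                     sigma_m (Q *m sampling_matrix
                                     (@uniform_distribution R n) (t ^~ w)))%R])%E].
Proof.
have /andP[d0 _] := delta01.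
have mR : 0 < m%:R :> R by rewrite ltr0n.
split; first exact: c1_bounds.
- move=> d T P c beta p t /andP[c0 _] /andP[b0 _] [pd pbeta] tP hc.
  have [tm _ _] := tP; have [p0 _] := pd.
  apply: (@sketch_sigma_ge _ _ _ _ _ _ _ (m%:R / beta) _ (fun s => \prod_j p (s j))
            _ _ _ _ m_gt0 orthoQ eps01 d0 c0 pd) => //.
  + by rewrite divr_gt0.
  + move=> i; have := pbeta i; rewrite frobenius_norm_sqr// two_norm_sqr.
    rewrite ler_pdivrMr// mulrC -ler_pdivlMr// mulrAC.
    by rewrite [_ * m%:R]mulrC mulrA mulrAC.
  + apply: le_trans hc; rewrite le_eqVlt; apply/orP; left; apply/eqP.
    by rewrite [(beta * _)^-1]invfM; ring.
  + by move=> s; exact: law_with_replacement tP.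
  + by move=> s; apply: prodr_ge0.
- move=> d T P c t /andP[c0 cn] tP hc.
  have n0 : (0 < n)%N by apply: leq_trans cn.
  have nR : 0 < n%:R :> R by rewrite ltr0n.
  have K0 : 0 < n%:R * coherence Q by rewrite mulr_gt0// coherence_gt0.
  have Kp i : sqnorm (col i Q) <= n%:R * coherence Q * uniform_distribution R i.
    rewrite /uniform_distribution mulrAC mulfV ?gt_eqF// mul1r.
    exact: sqnorm_col_le_coherence.
  have pd := @uniform_is_distribution R n n0.
  rewrite -(mulrA (c1 eps)) in hc.
  case: tP => tP.
    have [tm _ _] := tP.
    apply: (sketch_sigma_ge m_gt0 orthoQ eps01 d0 c0 pd K0 Kp hc tm
              (fun s => law_with_replacement s tP)) => // s.
    by apply: prodr_ge0 => j _; rewrite invr_ge0.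
  have [tm _] := tP.
  apply: (sketch_sigma_ge m_gt0 orthoQ eps01 d0 c0 pd K0 Kp hc tm
            (fun s => law_without_replacement s tP)) => [s|k k0].
    by case: ifP => // _; rewrite invr_ge0.
  exact: potential_without_replacement.
Qed.
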